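(* Let $\mathcal{G}=(V,E)$ be a connected hypergraph with $n\ge 3$ vertices such that $\mathcal{G}$ contains at least one pair of nonadjacent vertices and $d_{\max}\le cr(\mathcal{G})$. Then $\lambda_2(L_{\mathcal{G}})\le\kappa_W(\mathcal{G})$.
   Context: A hypergraph $\mathcal{G}=(V,E)$ has a finite vertex set $V$ and a set $E$ of subsets of $V$ (edges), each of cardinality at least $2$. Two distinct vertices $i,j$ are adjacent ($i\sim j$) if some edge contains both. The degree $d_i$ is the number of edges containing $i$, $d_{\max}=\max_i d_i$, and the co-rank $cr(\mathcal{G})$ is the minimum cardinality of an edge. The adjacency matrix $A_{\mathcal{G}}$ has $(A_{\mathcal{G}})_{ij}=\sum_{e\in E,\, i,j\in e}\frac{1}{|e|-1}$ for $i\ne j$ and zero diagonal; the Laplacian is $L_{\mathcal{G}}=D_{\mathcal{G}}-A_{\mathcal{G}}$ with $D_{\mathcal{G}}=\mathrm{diag}(d_i)$, i.e. $(L_{\mathcal{G}}f)(i)=\sum_{j\sim i}\sum_{e\ni i,j}\frac{1}{|e|-1}(f(i)-f(j))$. Its eigenvalues are ordered $\lambda_1(L_{\mathcal{G}})\le\lambda_2(L_{\mathcal{G}})\le\dots\le\lambda_n(L_{\mathcal{G}})$. Weak deletion of a set of vertices removes those vertices from $V$ and from every edge containing them. A weak vertex cut is a set of vertices whose weak deletion increases the number of connected components; $\kappa_W(\mathcal{G})$ is the minimum size of a weak vertex cut. *)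

(* Defs.v *)
From mathcomp Require Import all_boot all_order all_algebra.
Set Implicit Arguments. Unset Strict Implicit. Unset Printing Implicit Defensive.
Import Order.TTheory GRing.Theory Num.Theory.

Definition is_hypergraph (n : nat) (E : {set {set 'I_n}}) : Prop :=
  forall e, e \in E -> 2 <= #|e|.

Definition adjacent (n : nat) (E : {set {set 'I_n}}) (i j : 'I_n) : bool :=
  (i != j) && [exists e in E, (i \in e) && (j \in e)].

Definition hconnected (n : nat) (E : {set {set 'I_n}}) : Prop :=
  forall i j : 'I_n, connect (adjacent E) i j.

Definition hdeg (n : nat) (E : {set {set 'I_n}}) (i : 'I_n) : nat :=
  #|[set e in E | i \in e]|.

Definition dmax (n : nat) (E : {set {set 'I_n}}) : nat :=
  (\max_(i < n) hdeg E i)%N.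

(* co-rank: minimum edge cardinality (the default value n is only used when
   E is empty, which cannot happen under the theorem's hypotheses) *)
Definition corank (n : nat) (E : {set {set 'I_n}}) : nat :=
  \big[minn/n]_(e in E) #|e|.

Section Mat.
Local Open Scope ring_scope.
Definition hadj (R : fieldType) (n : nat) (E : {set {set 'I_n}}) : 'M[R]_n :=
  \matrix_(i, j) (if i == j then 0
                  else \sum_(e in E | (i \in e) && (j \in e)) ((#|e|).-1%:R)^-1).

Definition hlaplacian (R : fieldType) (n : nat) (E : {set {set 'I_n}}) : 'M[R]_n :=
  diag_mx (\row_i ((hdeg E i)%:R : R)) - hadj R E.
End Mat.

(* Weak deletion of S: vertices outside S, edges e :\: S.  Two remaining
   vertices are adjacent in the weakly deleted hypergraph iff they are
   adjacent in the original one. *)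
Definition wdel_adj (n : nat) (E : {set {set 'I_n}}) (S : {set 'I_n}) : rel 'I_n :=
  fun i j => [&& i \notin S, j \notin S & (i != j) &&
              [exists e in [set e :\: S | e in E], (i \in e) && (j \in e)]].

Definition ncomp_wdel (n : nat) (E : {set {set 'I_n}}) (S : {set 'I_n}) : nat :=
  n_comp (wdel_adj E S) (~: S).

Definition weak_vertex_cut (n : nat) (E : {set {set 'I_n}}) (S : {set 'I_n}) : bool :=
  ncomp_wdel E set0 < ncomp_wdel E S.

(* kappa_W: minimum size of a weak vertex cut (default n unused when a cut
   exists, which is guaranteed under the theorem's hypotheses) *)
Definition kappaW (n : nat) (E : {set {set 'I_n}}) : nat :=
  \big[minn/n]_(S : {set 'I_n} | weak_vertex_cut E S) #|S|.

(* Main.v *)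
Require Import Defs.
From mathcomp Require Import all_boot all_order all_algebra.
From mathcomp Require Import sesquilinear spectral complex.
Import Order.TTheory GRing.Theory Num.Theory.
Local Open Scope ring_scope.
Local Open Scope sesquilinear_scope.

(** Let [S] be a weak vertex cut of minimum size and let [A], [B] be the two sides of
    the complement of [S]. By minimality every [t] in [S] is adjacent to both sides; an
    edge joining [t] to one side contains no vertex of the other, so [t] shares at most
    [dmax - 1 <= corank - 1] edges with any vertex [x] outside [S], and the adjacency
    weight of [x] and [t] is at most [1]. Hence the quadratic form of the Laplacian is
    at most [#|S|] times the squared norm on the plane spanned by the indicators of [A]
    and [B], and by Courant-Fischer at least two eigenvalues are at most [#|S|]. The
    spectral theorem is applied over the complex numbers [R[i]]. *)

(** * Counting eigenvalues of Hermitian matrices *)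

Lemma char_poly_conj (F : fieldType) (n : nat) (P A : 'M[F]_n) :
  P \in unitmx -> char_poly (invmx P *m A *m P) = char_poly A.
Proof.
move=> Pu; rewrite /char_poly.
have -> : char_poly_mx (invmx P *m A *m P) =
    map_mx polyC (invmx P) *m char_poly_mx A *m map_mx polyC P.
  rewrite /char_poly_mx mulmxBr mulmxBl -!map_mxM /=; congr (_ - _).
  by rewrite -mulmxA mul_scalar_mx -scalemxAr -map_mxM mulVmx // map_mx1 scalemx1.
rewrite !det_mulmx mulrAC -det_mulmx -map_mxM mulVmx // map_mx1 det1.
exact: mul1r.
Qed.

Lemma dotmx_norm (C : numClosedFieldType) (n : nat) (v : 'rV[C]_n) :
  (v *m v^t*) 0 0 = \sum_j `|v 0 j| ^+ 2.
Proof. by rewrite mxE; apply: eq_bigr => j _; rewrite !mxE normCK. Qed.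

(** This is one half of Courant-Fischer. With fewer than [m] eigenvalues at most [c], some nonzero
    vector of the row space of [W] would have only eigencomponents with eigenvalue above [c], and
    its form would exceed the bound. *)
Lemma hermsymmx_count_eigenvalues (C : numClosedFieldType) (m n : nat)
    (M : 'M[C]_n) (s : seq C) (W : 'M[C]_(m, n)) (c : C) :
  M \is hermsymmx -> c \is Num.real ->
  char_poly M = \prod_(x <- s) ('X - x%:P) ->
  row_free W ->
  (forall v : 'rV_n, (v <= W)%MS ->
     (v *m M *m v^t*) 0 0 <= c * (v *m v^t*) 0 0) ->
  (m <= count (fun x => (x <= c)%R) s)%N.
Proof.
move=> Mh cr Ms Wf Wc.
have dr := hermitian_spectral_diag_real Mh.
have /orthomx_spectralP ME := hermitian_normalmx Mh.
have Pu := spectral_unitarymx M.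
set P := spectralmx M in ME Pu; set d := spectral_diag M in ME dr.
pose I := [set i | d 0 i <= c].
have -> : count (fun x => (x <= c)%R) s = #|I|.
  (* Both lists are the roots of the same split polynomial, so they agree as multisets. *)
  have : perm_eq s [seq d 0 i | i <- enum 'I_n].
    apply: prod_XsubC_eq; rewrite -Ms ME char_poly_conj ?unitarymx_unit //.
    rewrite char_poly_trig ?diag_mx_is_trig // big_map big_enum /=.
    by apply: eq_bigr => i _; rewrite mxE eqxx mulr1n.
  move/permP => ->; rewrite count_map -sum1_count big_enum_cond /= -sum1_card.
  by apply: eq_bigl => i; rewrite inE.
rewrite leqNgt; apply/negP => ltIm.
(* [K] keeps the eigenbasis coordinates indexed by [I]. It has fewer columns than rows, hence a
   nonzero left kernel. *)
pose K := colsub (fun j : 'I_#|I| => enum_val j) (W *m P^t* ).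
have Kn : kermx K != 0.
  rewrite -mxrank_eq0 mxrank_ker -lt0n subn_gt0.
  exact: leq_ltn_trans (rank_leq_col _) ltIm.
pose u := nz_row (kermx K); pose v := u *m W; pose y := v *m P^t*.
have vn : v != 0 by rewrite mulmx_free_eq0 // nz_row_eq0.
have vE : v = y *m P by rewrite mulmxKtV.
have yn : y != 0 by apply: contraNneq vn => y0; rewrite vE y0 mul0mx.
have yI i : i \in I -> y 0 i = 0.
  move=> iI; have /sub_kermxP uK : (u <= kermx K)%MS by exact: nz_row_sub.
  have /rowP/(_ (enum_rank_in iI i)) := uK.
  rewrite /K mulmx_colsub mxE enum_rankK_in // mulmxA -/v -/y => ->.
  by rewrite mxE.
have := Wc v (submxMl _ _).
have yE : y^t* = P *m v^t* by rewrite trmx_mul map_mxM trmxCK.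
have -> : v *m M *m v^t* = y *m diag_mx d *m y^t*.
  by rewrite yE [in LHS]ME invmx_unitary // !mulmxA.
have -> : v *m v^t* = y *m y^t* by rewrite yE mulmxA -vE.
rewrite dotmx_norm mxE mulr_sumr -subr_ge0 -sumrB; apply/negP.
have [j yj] : exists j, y 0 j != 0.
  apply/existsP; apply: contraNT yn => /existsPn y0.
  by apply/eqP/rowP => j; have /negPn/eqP -> := y0 j; rewrite mxE.
(* The order on [C] is partial: negating [d 0 i <= c] requires both sides to be real. *)
have Er i : y 0 i != 0 -> c < d 0 i.
  move=> yi; rewrite real_ltNge ?(mxOverP dr) //.
  by apply: contraNN yi => di; rewrite yI // inE.
have tE i : c * `|y 0 i| ^+ 2 - (y *m diag_mx d) 0 i * (y^t*) i 0 =
    - ((d 0 i - c) * `|y 0 i| ^+ 2).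
  rewrite mul_mx_diag !mxE normCK mulrBl opprB; congr (_ - _).
  by rewrite mulrAC mulrC.
under eq_bigr do rewrite tE.
rewrite sumrN oppr_ge0.
have Spos : 0 < \sum_i (d 0 i - c) * `|y 0 i| ^+ 2.
  rewrite (bigD1 j) //= ltr_pwDl ?mulr_gt0 ?subr_gt0 ?Er ?exprn_gt0 ?normr_gt0 //.
  apply: sumr_ge0 => i _; have [->|yi] := eqVneq (y 0 i) 0.
    by rewrite normr0 expr0n mulr0.
  by rewrite mulr_ge0 ?exprn_ge0 // subr_ge0 ltW // Er.
by rewrite lt_geF.
Qed.

(** * Weak deletion and minimum weak cuts *)

Lemma adjacent_sym (n : nat) (E : {set {set 'I_n}}) : symmetric (adjacent E).
Proof.
move=> i j; rewrite /adjacent eq_sym; congr (_ && _).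
by apply: eq_existsb => e; rewrite [X in _ && X]andbC.
Qed.

Lemma wdel_adjE (n : nat) (E : {set {set 'I_n}}) (S : {set 'I_n}) (i j : 'I_n) :
  wdel_adj E S i j = [&& i \notin S, j \notin S & adjacent E i j].
Proof.
rewrite /wdel_adj /adjacent; case: (boolP (i \in S)) => //= iS.
case: (boolP (j \in S)) => //= jS; congr (_ && _).
apply/exists_inP/exists_inP => [[_ /imsetP[e eE ->]]|[e eE ije]].
  by rewrite !inE iS jS => ije; exists e.
by exists (e :\: S); [exact: imset_f | rewrite !inE iS jS].
Qed.

Lemma wdel_adj_sym (n : nat) (E : {set {set 'I_n}}) (S : {set 'I_n}) :
  symmetric (wdel_adj E S).
Proof.
by move=> i j; rewrite !wdel_adjE adjacent_sym; case: (i \in S); case: (j \in S).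
Qed.

Lemma wdel_connect_sym (n : nat) (E : {set {set 'I_n}}) (S : {set 'I_n}) :
  connect_sym (wdel_adj E S).
Proof. exact/sym_connect_sym/wdel_adj_sym. Qed.

Lemma wdel_adj_closed (n : nat) (E : {set {set 'I_n}}) (S : {set 'I_n}) :
  closed (wdel_adj E S) (~: S).
Proof. by move=> i j; rewrite wdel_adjE !inE => /and3P[-> ->]. Qed.

Lemma weak_vertex_cutP (n : nat) (E : {set {set 'I_n}}) (S : {set 'I_n}) :
  hconnected E ->
  reflect (exists i j, [/\ i \notin S, j \notin S & ~~ connect (wdel_adj E S) i j])
          (weak_vertex_cut E S).
Proof.
move=> Econ; have sc := wdel_connect_sym n E; have cl := wdel_adj_closed n E.
have con0 i j : connect (wdel_adj E set0) i j.
  by rewrite (eq_connect (e' := adjacent E)) // => x y; rewrite wdel_adjE !inE.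
have root_out (T : {set 'I_n}) i : i \notin T ->
    fingraph.root (wdel_adj E T) i \in predI (roots (wdel_adj E T)) (mem (~: T)).
  move=> iT; rewrite inE /= roots_root //=.
  by rewrite -(closed_connect (cl T) (connect_root _ _)) inE.
apply: (iffP idP) => [cutS|[i [j [iS jS nij]]]].
  (* The cut gives only one component more than [set0] does; a vertex surviving in [~: S] shows that
     [set0] already leaves at least one. *)
  have : (1 < ncomp_wdel E S)%N.
    apply: (leq_trans _ cutS); rewrite ltnS.
    have /card_gt0P[i _] : (0 < ncomp_wdel E S)%N by exact: leq_ltn_trans cutS.
    by apply/card_gt0P; exists (fingraph.root (wdel_adj E set0) i); rewrite root_out ?inE.
  case/card_gt1P=> i [j [/andP[/eqP ri iS] /andP[/eqP rj jS] nij]].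
  exists i, j; move: iS jS; rewrite !inE => -> ->; split=> //.
  by apply: contraNN nij => /(fingraph.rootP (sc S)); rewrite ri rj => ->.
apply: (@leq_ltn_trans 1).
  apply/card_le1_eqP => x y /andP[/eqP rx _] /andP[/eqP ry _].
  by rewrite -rx -ry; apply/(fingraph.rootP (sc set0)).
apply/card_gt1P; exists (fingraph.root (wdel_adj E S) i), (fingraph.root (wdel_adj E S) j).
by rewrite !root_out //; split=> //; rewrite root_connect.
Qed.

Lemma corank_le (n : nat) (E : {set {set 'I_n}}) (e : {set 'I_n}) :
  e \in E -> (corank E <= #|e|)%N.
Proof.
move=> eE; have := mem_index_enum e; rewrite /corank.
elim: (index_enum _) => // f r IH; rewrite inE big_cons => /predU1P[<-|/IH er].
  by rewrite eE geq_minl.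
by case: ifP => // _; rewrite geq_min er orbT.
Qed.

(** Only [i] and [j] survive the deletion, so [i] is isolated. This provides the cut from which a
    minimum one is extracted. *)
Lemma nonadjacent_weak_cut (n : nat) (E : {set {set 'I_n}}) (i j : 'I_n) :
  hconnected E -> i != j -> ~~ adjacent E i j -> weak_vertex_cut E (~: [set i; j]).
Proof.
move=> Econ nij nadj; apply/weak_vertex_cutP => //; exists i, j.
rewrite !inE !eqxx orbT; split=> //; apply: contraNN nij => ij.
have cl : closed (wdel_adj E (~: [set i; j])) (pred1 i).
  apply: (intro_closed (wdel_connect_sym _ _ _)) => x y; rewrite wdel_adjE !inE !negbK.
  move=> /and3P[_ /orP[//|/eqP ->]] /[swap] /eqP ->.
  by rewrite (negPf nadj).
by have := closed_connect cl ij; rewrite !inE eqxx eq_sym => <-.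
Qed.

(** The boolean [b] selects a side: the component of [i], or the rest of the complement of [S]. If
    [s] had no neighbour on that side, putting [s] back would leave the side closed, and [S :\ s]
    would be a smaller cut. *)
Lemma min_weak_cut_adjacent (n : nat) (E : {set {set 'I_n}}) (S : {set 'I_n})
    (i j s : 'I_n) (b : bool) :
  hconnected E ->
  (forall T, weak_vertex_cut E T -> #|S| <= #|T|)%N ->
  i \notin S -> j \notin S -> ~~ connect (wdel_adj E S) i j -> s \in S ->
  exists x, [/\ x \notin S, adjacent E s x & connect (wdel_adj E S) i x = b].
Proof.
move=> Econ minS iS jS nij sS.
case: (pickP [pred x | [&& x \notin S, adjacent E s x
                         & connect (wdel_adj E S) i x == b]]) => [x|none].
  by move=> /and3P[xS sx /eqP xb]; exists x.
have /minS : weak_vertex_cut E (S :\ s).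
  apply/weak_vertex_cutP => //; exists i, j.
  rewrite !inE (negPf iS) (negPf jS) !andbF; split=> //; apply/negP => ij.
  pose a := [pred x | (x \notin S) && (connect (wdel_adj E S) i x == b)].
  have cl : closed (wdel_adj E (S :\ s)) a.
    apply: (intro_closed (wdel_connect_sym _ _ _)) => x y; rewrite wdel_adjE !inE.
    move=> /and3P[_ yS xy] /andP[xS xb]; have := none x; rewrite /= xS xb andbT /=.
    move: yS; rewrite negb_and negbK => /predU1P[<-|yS]; first by rewrite adjacent_sym xy.
    move=> _; rewrite yS /= -(eqP xb); apply/eqP.
    apply/esym/(same_connect_r (wdel_connect_sym _ _ _))/connect1.
    by rewrite wdel_adjE xS yS.
  have := closed_connect cl ij; rewrite !inE iS jS connect0 (negPf nij).
  by case: (b).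
by rewrite leqNgt [in X in (_ < X)%N](cardsD1 s) sS ltnS leqnn.
Qed.

(** * Adjacency weights *)

Lemma hadj_sym (R : numFieldType) (n : nat) (E : {set {set 'I_n}})
    (i j : 'I_n) : hadj R E i j = hadj R E j i.
Proof.
rewrite !mxE eq_sym; case: ifP => // _.
by apply: eq_bigl => e; rewrite [X in _ && X]andbC.
Qed.

Lemma hadj_ge0 (R : numFieldType) (n : nat) (E : {set {set 'I_n}})
    (i j : 'I_n) : 0 <= hadj R E i j.
Proof. by rewrite mxE; case: ifP => // _; apply: sumr_ge0 => e _; rewrite invr_ge0. Qed.

Lemma hadj_nonadjacent (R : numFieldType) (n : nat) (E : {set {set 'I_n}})
    (i j : 'I_n) : ~~ adjacent E i j -> hadj R E i j = 0.
Proof.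
rewrite mxE /adjacent; case: (eqVneq i j) => //= _ /exists_inPn none.
by rewrite big1 // => e /andP[/none/negPf->].
Qed.

(** After exchanging the sums, each edge [e] through [i] contributes [#|e| - 1] terms equal to the
    inverse of [#|e| - 1], which is nonzero since edges have at least two vertices. *)
Lemma hadj_row_sum (R : numFieldType) (n : nat) (E : {set {set 'I_n}})
    (i : 'I_n) :
  is_hypergraph E -> \sum_j hadj R E i j = (hdeg E i)%:R.
Proof.
move=> hE; rewrite (bigD1 i) //= mxE eqxx add0r.
transitivity (\sum_(j | j != i) \sum_(e in E | (i \in e) && (j \in e))
                 ((#|e|).-1%:R : R)^-1).
  by apply: eq_bigr => j ji; rewrite mxE eq_sym (negPf ji).
rewrite (exchange_big_dep (fun e => (e \in E) && (i \in e))) /=; last first.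
  by move=> j e _ /and3P[-> ->].
rewrite /hdeg -sum1_card natr_sum; apply: eq_big => [e|e /andP[eE ie]].
  by rewrite inE.
rewrite (eq_bigl (fun j => j \in e :\ i)); last by move=> j; rewrite !inE eE ie.
have -> : (#|e|).-1 = #|e :\ i| by rewrite [in LHS](cardsD1 i) ie.
rewrite sumr_const -[LHS]mulr_natl mulfV // pnatr_eq0 -lt0n.
by have := hE _ eE; rewrite (cardsD1 i) ie.
Qed.

Lemma hadj_min_weak_cut_le1 (R : numFieldType) (n : nat) (E : {set {set 'I_n}})
    (S : {set 'I_n}) (i j s x : 'I_n) :
  hconnected E -> (dmax E <= corank E)%N ->
  (forall T, weak_vertex_cut E T -> #|S| <= #|T|)%N ->
  i \notin S -> j \notin S -> ~~ connect (wdel_adj E S) i j ->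
  s \in S -> x \notin S -> hadj R E x s <= 1.
Proof.
move=> Econ dc minS iS jS nij sS xS.
(* Take a neighbour [y] of [s] on the side opposite to [x]; the edge [e0] joining [s] to [y] must
   then miss [x]. *)
have [y [yS]] := min_weak_cut_adjacent _ _ _ _ _ _ (~~ connect (wdel_adj E S) i x)
  Econ minS iS jS nij sS.
case/andP=> _ /exists_inP[e0 e0E /andP[se0 ye0]] yx.
have xe0 : x \notin e0.
  apply/negP => xe0; have xy : x != y.
    by apply: contra_eq_neq yx => ->; case: connect.
  suff /connect1/(same_connect_r (wdel_connect_sym _ _ _))/(_ i) : wdel_adj E S x y.
    by rewrite yx; case: connect.
  rewrite wdel_adjE xS yS /adjacent xy /=; apply/exists_inP.
  by exists e0 => //; rewrite xe0.
have xs : x != s by apply: contraNneq xS => ->.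
rewrite mxE (negPf xs).
pose D := [set e in E | (x \in e) && (s \in e)].
(* The edge [e0] counts in the degree of [s] but is not in [D], whence the strict inequality. *)
have Dlt : (#|D| < corank E)%N.
  apply: leq_trans dc; apply: leq_trans (leq_bigmax (F := hdeg E) s).
  rewrite /hdeg (cardsD1 e0 [set e in E | s \in e]) inE e0E se0 ltnS.
  apply: subset_leq_card; apply/subsetP => e; rewrite !inE => /and3P[-> xe ->].
  by rewrite !andbT; apply: contraNneq xe0 => <-.
rewrite (eq_bigl (mem D)); last by move=> e; rewrite !inE.
(* Every edge has [#|e| - 1 >= #|D|], so each of the [#|D|] weights is at most the inverse of
   [#|D|]. *)
apply: (@le_trans _ _ (\sum_(e in D) (#|D|%:R : R)^-1)).
  apply: ler_sum => e eD; have D0 : (0 < #|D|)%N by apply/card_gt0P; exists e.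
  have /setIdP[eE _] : e \in D by [].
  have De : (#|D| <= #|e|.-1)%N.
    by have := leq_trans Dlt (corank_le _ _ _ eE); case: #|e|.
  by rewrite lef_pV2 ?ler_nat // posrE ltr0n // (leq_trans D0).
rewrite sumr_const -[leLHS]mulr_natl; have [->|D0] := eqVneq #|D| 0%N; first by rewrite mul0r.
by rewrite mulfV // pnatr_eq0.
Qed.

(** * The Laplacian form and the test plane *)

Lemma hlaplacian_hermsym (C : numClosedFieldType) (n : nat) (E : {set {set 'I_n}}) :
  hlaplacian C E \is hermsymmx.
Proof.
apply/is_hermitianmxP; rewrite expr0 scale1r; apply/matrixP => i j.
have LE k l : hlaplacian C E k l = (hdeg E k)%:R *+ (k == l) - hadj C E k l.
  by rewrite mxE [X in X + _]mxE [X in _ + X]mxE [X in X *+ _]mxE.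
rewrite [RHS]mxE [_^T i j]mxE !LE rmorphB rmorphMn /= conjC_nat (hadj_sym _ _ E j i).
rewrite (CrealP (ger0_real (hadj_ge0 C n E i j))) eq_sym.
by have [->|] := eqVneq i j.
Qed.

Lemma map_hlaplacian (K F : fieldType) (f : {rmorphism K -> F}) (n : nat)
    (E : {set {set 'I_n}}) : map_mx f (hlaplacian K E) = hlaplacian F E.
Proof.
apply/matrixP => i j; rewrite !mxE rmorphB rmorphMn rmorph_nat /=; congr (_ - _).
case: ifP => _; first exact: rmorph0.
by rewrite rmorph_sum; apply: eq_bigr => e _; rewrite /= fmorphV rmorph_nat.
Qed.

(* [v L] is computed at [x] outside [S] by replacing the degree by the row sum of the
   adjacency matrix: only the neighbours of [x] in [S] contribute. *)
Lemma hlaplacian_form_le (C : numClosedFieldType) (n : nat) (E : {set {set 'I_n}})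
    (S : {set 'I_n}) (v : 'rV[C]_n) :
  is_hypergraph E ->
  {in S, forall x, v 0 x = 0} ->
  (forall x y, x \notin S -> y \notin S -> adjacent E x y -> v 0 x = v 0 y) ->
  (forall x s, x \notin S -> s \in S -> hadj C E x s <= 1) ->
  (v *m hlaplacian C E *m v^t*) 0 0 <= #|S|%:R * (v *m v^t*) 0 0.
Proof.
move=> hE vS vadj w1; rewrite dotmx_norm mxE mulr_sumr.
apply: ler_sum => x _; rewrite [(v^t*) x 0]mxE [v^T x 0]mxE.
have [xS|xS] := boolP (x \in S).
  by rewrite vS // normr0 expr0n conjC0 !mulr0.
have -> : (v *m hlaplacian C E) 0 x = v 0 x * \sum_(s in S) hadj C E x s.
  rewrite mulmxBr mul_mx_diag [LHS]mxE [X in X + _]mxE [X in _ + X]mxE [X in _ - X]mxE.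
  rewrite [X in _ * X - _]mxE -(hadj_row_sum C n E x hE) !mulr_sumr -sumrB.
  rewrite [RHS]big_mkcond /=; apply: eq_bigr => y _; rewrite (hadj_sym _ _ E y x).
  case: ifPn => [yS|yS]; first by rewrite (vS y yS) mul0r subr0.
  have [xy|nxy] := boolP (adjacent E x y); first by rewrite (vadj x y) // subrr.
  by rewrite hadj_nonadjacent // !mulr0 subrr.
rewrite mulrAC -normCK mulrC ler_wpM2r ?exprn_ge0 //.
by rewrite -sumr_const; apply: ler_sum => s sS; apply: w1.
Qed.

(** Its row space consists of vectors vanishing on [S] and constant on each side of the cut. *)
Definition two_side_mx (C : fieldType) (n : nat) (S : {set 'I_n}) (a : pred 'I_n) :
    'M[C]_(2, n) :=
  \matrix_(k, x) ((x \notin S) && (a x == (k == 0)))%:R.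

Lemma two_side_mx_free (C : fieldType) (n : nat) (S : {set 'I_n}) (a : pred 'I_n)
    (i j : 'I_n) :
  i \notin S -> j \notin S -> a i -> ~~ a j -> row_free (two_side_mx C n S a).
Proof.
move=> iS jS ai /negPf aj; apply/row_freeP.
(* Selecting the columns [i] and [j], one on each side, leaves the identity, which gives a right
   inverse. *)
pose p (k : 'I_2) := if k == 0 then i else j.
exists (\matrix_(x, k) (x == p k)%:R); apply/matrixP => k l.
rewrite !mxE (bigD1 (p l)) //= big1 => [|x /negPf xl]; last by rewrite !mxE xl mulr0.
rewrite !mxE eqxx mulr1 addr0 /p.
by case: k l => [[|[|//]] ?] [[|[|//]] ?]; rewrite /= ?iS ?jS ?ai ?aj.
Qed.

(** * From the count to the second eigenvalue *)

Lemma sorted_count_le_nth (R : realDomainType) (s : seq R) (c : R) (k : nat) :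
  sorted <=%R s -> (k < count (fun x => (x <= c)%R) s)%N -> s`_k <= c.
Proof.
(* If entry [k] exceeds [c], so do all later ones, and only the first [k] entries can be counted. *)
move=> ss; rewrite leNgt; apply: contraTN => ck; rewrite -leqNgt.
rewrite -[s](cat_take_drop k) count_cat [X in (_ + X)%N](_ : _ = 0%N).
  by rewrite addn0 (leq_trans (count_size _ _)) // size_take_min geq_minl.
apply/eqP; rewrite -leqn0 leqNgt -has_count; apply/hasPn => x.
case/(nthP 0) => m; rewrite size_drop nth_drop ltn_subRL => km <-.
rewrite -ltNge (lt_le_trans ck) //.
apply: (sorted_leq_nth le_trans le_refl) => //; rewrite ?inE ?leq_addr //.
by apply: leq_ltn_trans km; rewrite leq_addr.
Qed.

(* s is the nondecreasing list of eigenvalues of L (with multiplicity),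
   so s`_1 = lambda_2(L). *)
Theorem theorem5 (R : rcfType) (n : nat) (E : {set {set 'I_n}}) (s : seq R) :
  is_hypergraph E ->
  (3 <= n)%N ->
  hconnected E ->
  (exists i j : 'I_n, i != j /\ ~~ adjacent E i j) ->
  (dmax E <= corank E)%N ->
  sorted <=%R s ->
  char_poly (hlaplacian R E) = \prod_(x <- s) ('X - x%:P) ->
  s`_1 <= (kappaW E)%:R.
Proof.
move=> hE _ Econ [i0 [j0 [nij0 nadj]]] dc ss sE.
have cut0 := nonadjacent_weak_cut _ _ _ _ Econ nij0 nadj.
case: (arg_minnP (fun S : {set 'I_n} => #|S|) cut0) => S Scut minS.
apply: (@le_trans _ _ #|S|%:R); last first.
  (* The minimum is bounded below termwise; the default [n] is covered because [S] is a set of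
     vertices. *)
  rewrite ler_nat /kappaW; elim/big_ind: _ => // [|x y Sx Sy].
    by rewrite -[X in (_ <= X)%N]card_ord max_card.
  by rewrite leq_min Sx Sy.
have [i [j [iS jS nij]]] := weak_vertex_cutP _ _ _ Econ Scut.
pose a := connect (wdel_adj E S) i.
apply: (sorted_count_le_nth _ _ _ _ ss).
pose C : numClosedFieldType := R[i]%C.
pose f : {rmorphism R -> C} := real_complex R.
(* The embedding of [R] in [R[i]] preserves and reflects the order, so the count may be taken over
   [C]. *)
have -> : count (fun x => (x <= #|S|%:R)%R) s =
    count (fun x : C => (x <= #|S|%:R)%R) (map f s).
  rewrite count_map; apply: eq_count => x /=.
  by rewrite -[#|S|%:R in RHS](rmorph_nat f) lecR.
apply: (hermsymmx_count_eigenvalues C _ _ (hlaplacian C E) _ (two_side_mx C n S a)).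
- exact: hlaplacian_hermsym.
- exact: realn.
- rewrite -(map_hlaplacian _ _ f) -map_char_poly sE rmorph_prod big_map.
  by apply: eq_bigr => x _; rewrite /= map_polyXsubC.
- by apply: two_side_mx_free iS jS _ nij; apply: connect0.
move=> v /submxP[u ->]; apply: hlaplacian_form_le => // [x xS|x y xS yS xy|x t xS tS].
- by rewrite mxE big1 // => k _; rewrite mxE xS mulr0.
- rewrite !mxE; apply: eq_bigr => k _; rewrite !mxE xS yS /a.
  rewrite (same_connect_r (wdel_connect_sym _ _ _) (y := y)) //.
  by apply: connect1; rewrite wdel_adjE xS yS.
- exact: (hadj_min_weak_cut_le1 C n E S i j).
Qed.
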